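(* Let $\mathbf{J}$ be a small category and $\Omega$ a weakly initial class of objects of $\mathbf{J}$. A dagger category $\mathbf{C}$ has all $(\mathbf{J},\Omega)$-shaped dagger limits if and only if the diagonal functor $\Delta\colon\mathbf{C}\to\mathbf{Cat}(\mathbf{J},\mathbf{C})$ has a right adjoint $L$ such that, writing $\varepsilon\colon\Delta L\to\mathrm{id}$ for the counit and $d_A\colon L(D)\to D(A)$ for the component of $\varepsilon_D$ at $A$ (for $D\colon\mathbf{J}\to\mathbf{C}$ and $A\in\mathbf{J}$): (1) the counit is a partial isometry when restricted to $\Omega$, i.e. $d_A$ is a partial isometry for every functor $D\colon\mathbf{J}\to\mathbf{C}$ and every $A\in\Omega$; (2) $L$ restricts to a dagger functor $\hat{L}\colon[\mathbf{J},\mathbf{C}]_\dagger\to\mathbf{C}$; (3) for every $A\in\Omega$ the family $(\rho_A)_D=d_A^\dagger d_A\colon L(D)\to L(D)$ is a natural transformation $\rho_A\colon\hat{L}\Rightarrow\hat{L}$; (4) if $A,B\in\Omega$, then $\rho_A\rho_B=\rho_B\rho_A$.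
   Context: A dagger category is a category $\mathbf{C}$ equipped with an identity-on-objects functor $\dagger\colon\mathbf{C}^{\mathrm{op}}\to\mathbf{C}$ satisfying $f^{\dagger\dagger}=f$. A dagger functor is a functor $F$ between dagger categories with $F(f^\dagger)=F(f)^\dagger$. A morphism $f$ is a partial isometry if $f=ff^\dagger f$. A class $\Omega$ of objects of $\mathbf{J}$ is weakly initial if every object of $\mathbf{J}$ receives a morphism from some object in $\Omega$. A dagger limit of $(D,\Omega)$, for $D\colon\mathbf{J}\to\mathbf{C}$, is a limit $(L,l_A\colon L\to D(A))$ of $D$ such that $l_A$ is a partial isometry for all $A\in\Omega$ and $l_A^\dagger l_A l_B^\dagger l_B=l_B^\dagger l_B l_A^\dagger l_A$ for all $A,B\in\Omega$. $\mathbf{C}$ has all $(\mathbf{J},\Omega)$-shaped dagger limits if $(D,\Omega)$ has a dagger limit for every functor $D\colon\mathbf{J}\to\mathbf{C}$. $\mathbf{Cat}(\mathbf{J},\mathbf{C})$ is the category of all functors $\mathbf{J}\to\mathbf{C}$ and all natural transformations; $\Delta$ sends an object to the constant functor. A natural transformation $\sigma\colon D\Rightarrow E$ between functors $D,E\colon\mathbf{J}\to\mathbf{C}$ is adjointable if the componentwise daggers $\sigma_A^\dagger$ form a natural transformation $\sigma^\dagger\colon E\Rightarrow D$. $[\mathbf{J},\mathbf{C}]_\dagger$ is the dagger category of all functors $\mathbf{J}\to\mathbf{C}$ and adjointable natural transformations, with componentwise dagger. *)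

(* Defs.v *)
From Stdlib Require Import ssreflect ssrfun.
From Stdlib Require Import FunctionalExtensionality ProofIrrelevance.

Set Implicit Arguments.
Unset Strict Implicit.
Unset Printing Implicit Defensive.
#[local] Obligation Tactic := idtac.

Declare Scope cat_scope.
Delimit Scope cat_scope with cat.
Local Open Scope cat_scope.

(* Objects and morphisms form types, so every [category] is small in the sense
   of its universe; a category that is small for one universe lives in every larger
   one as well, so the index category and the category in which limits are
   taken need not be of the same size. *)
Record category := Category {
  ob :> Type;
  hom : ob -> ob -> Type;
  idm : forall x, hom x x;
  comp : forall x y z, hom y z -> hom x y -> hom x z;
  comp1m : forall x y (f : hom x y), comp (idm y) f = f;
  compm1 : forall x y (f : hom x y), comp f (idm x) = f;
  compA : forall w x y z (h : hom y z) (g : hom x y) (f : hom w x),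
      comp h (comp g f) = comp (comp h g) f
}.

Arguments hom {_} _ _.
Arguments idm {_} _.
Arguments comp {_ _ _ _} _ _.

Notation "g ∘ f" := (comp g f) (at level 40, left associativity) : cat_scope.

(* An identity-on-objects functor from the opposite category, given by its
   action on morphisms. *)
Record dagger_category := DaggerCategory {
  dag_cat :> category;
  dag : forall x y : dag_cat, hom x y -> hom y x;
  dag1 : forall x : dag_cat, dag (idm x) = idm x;
  dagM : forall (x y z : dag_cat) (g : hom y z) (f : hom x y),
      dag (g ∘ f) = dag f ∘ dag g;
  dagK : forall (x y : dag_cat) (f : hom x y), dag (dag f) = f
}.

Arguments dag {_ _ _} _.

Notation "f †" := (dag f) (at level 2, left associativity, format "f †")
  : cat_scope.

Definition partial_isometry (C : dagger_category) (x y : C) (f : hom x y) : Prop :=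
  f = f ∘ f† ∘ f.

Record functor (J C : category) := Functor {
  fobj :> J -> C;
  fmap : forall x y : J, hom x y -> hom (fobj x) (fobj y);
  fmap1 : forall x : J, fmap (idm x) = idm (fobj x);
  fmapM : forall (x y z : J) (g : hom y z) (f : hom x y),
      fmap (g ∘ f) = fmap g ∘ fmap f
}.

Arguments fmap {_ _} _ {_ _} _.

Definition is_dagger_functor (C D : dagger_category) (F : functor C D) : Prop :=
  forall (x y : C) (f : hom x y), fmap F (f†) = (fmap F f)†.

Definition idF (C : category) : functor C C :=
  @Functor C C (fun x => x) (fun x y f => f) (fun _ => erefl)
    (fun _ _ _ _ _ => erefl).

Program Definition compF (A B C : category) (G : functor B C) (F : functor A B) :
    functor A C :=
  @Functor A C (fun x => G (F x)) (fun x y f => fmap G (fmap F f)) _ _.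
Next Obligation. by move=> A B C G F x /=; rewrite !fmap1. Qed.
Next Obligation. by move=> A B C G F x y z g f /=; rewrite !fmapM. Qed.

Program Definition constF (J C : category) (c : C) : functor J C :=
  @Functor J C (fun _ => c) (fun x y f => idm c) (fun _ => erefl) _.
Next Obligation. by move=> J C c x y z g f /=; rewrite comp1m. Qed.

Definition is_natural (J C : category) (F G : functor J C)
    (t : forall A, hom (F A) (G A)) : Prop :=
  forall (A B : J) (f : hom A B), fmap G f ∘ t A = t B ∘ fmap F f.

Record nat_trans (J C : category) (F G : functor J C) := NatTrans {
  component :> forall A, hom (F A) (G A);
  naturality : is_natural component
}.

Lemma nat_trans_eq (J C : category) (F G : functor J C) (s t : nat_trans F G) :
  (forall A, s A = t A) -> s = t.
Proof.
case: s t => [s hs] [t ht] /= st.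
have e : s = t by apply: functional_extensionality_dep.
by subst t; rewrite (proof_irrelevance _ hs ht).
Qed.

Program Definition idN (J C : category) (F : functor J C) : nat_trans F F :=
  @NatTrans J C F F (fun A => idm (F A)) _.
Next Obligation. by move=> J C F A B f; rewrite comp1m compm1. Qed.

Program Definition compN (J C : category) (F G H : functor J C)
    (t : nat_trans G H) (s : nat_trans F G) : nat_trans F H :=
  @NatTrans J C F H (fun A => t A ∘ s A) _.
Next Obligation.
by move=> J C F G H t s A B f; rewrite compA naturality -compA naturality compA.
Qed.

Program Definition Cat (J C : category) : category :=
  @Category (functor J C) (@nat_trans J C) (@idN J C) (@compN J C) _ _ _.
Next Obligation. by move=> *; apply: nat_trans_eq => A; apply: comp1m. Qed.
Next Obligation. by move=> *; apply: nat_trans_eq => A; apply: compm1. Qed.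
Next Obligation. by move=> *; apply: nat_trans_eq => A; apply: compA. Qed.

Definition adjointable (J : category) (C : dagger_category) (D E : functor J C)
    (s : nat_trans D E) : Prop :=
  @is_natural J C E D (fun A => (s A)†).

Record adj_trans (J : category) (C : dagger_category) (D E : functor J C) :=
  AdjTrans {
    adj_nat :> nat_trans D E;
    adj_adjointable : adjointable adj_nat
  }.

Lemma adj_trans_eq (J : category) (C : dagger_category) (D E : functor J C)
    (s t : adj_trans D E) : (forall A, s A = t A) -> s = t.
Proof.
case: s t => [s hs] [t ht] /= /nat_trans_eq e.
by subst t; rewrite (proof_irrelevance _ hs ht).
Qed.

Program Definition idAN (J : category) (C : dagger_category) (F : functor J C) :
    adj_trans F F :=
  @AdjTrans J C F F (idN F) _.
Next Obligation. by move=> J C F A B f; rewrite /= !dag1 comp1m compm1. Qed.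

Program Definition compAN (J : category) (C : dagger_category)
    (F G H : functor J C) (t : adj_trans G H) (s : adj_trans F G) :
    adj_trans F H :=
  @AdjTrans J C F H (compN t s) _.
Next Obligation.
move=> J C F G H t s A B f; rewrite /= !dagM compA.
by rewrite (adj_adjointable s) -compA (adj_adjointable t) compA.
Qed.

Program Definition dagN (J : category) (C : dagger_category) (D E : functor J C)
    (s : adj_trans D E) : adj_trans E D :=
  @AdjTrans J C E D (NatTrans (adj_adjointable s)) _.
Next Obligation.
by move=> J C D E s A B f; rewrite /= !dagK; apply: naturality.
Qed.

Program Definition AdjCat (J : category) (C : dagger_category) : category :=
  @Category (functor J C) (@adj_trans J C) (@idAN J C) (@compAN J C) _ _ _.
Next Obligation. by move=> *; apply: adj_trans_eq => A; apply: comp1m. Qed.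
Next Obligation. by move=> *; apply: adj_trans_eq => A; apply: compm1. Qed.
Next Obligation. by move=> *; apply: adj_trans_eq => A; apply: compA. Qed.

Program Definition DagCat (J : category) (C : dagger_category) : dagger_category :=
  @DaggerCategory (AdjCat J C) (@dagN J C) _ _ _.
Next Obligation. by move=> *; apply: adj_trans_eq => A; apply: dag1. Qed.
Next Obligation. by move=> *; apply: adj_trans_eq => A; apply: dagM. Qed.
Next Obligation. by move=> *; apply: adj_trans_eq => A; apply: dagK. Qed.

Definition DagCat_incl (J : category) (C : dagger_category) :
    functor (DagCat J C) (Cat J C) :=
  @Functor (DagCat J C) (Cat J C) (fun D => D) (fun D E s => adj_nat s)
    (fun _ => erefl) (fun _ _ _ _ _ => erefl).

Program Definition constN (J C : category) (x y : C) (f : hom x y) :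
    nat_trans (constF J x) (constF J y) :=
  @NatTrans J C (constF J x) (constF J y) (fun _ => f) _.
Next Obligation. by move=> J C x y f A B g; rewrite /= comp1m compm1. Qed.

Program Definition Delta (J C : category) : functor C (Cat J C) :=
  @Functor C (Cat J C) (@constF J C) (@constN J C) _ _.
Next Obligation. by move=> *; apply: nat_trans_eq. Qed.
Next Obligation. by move=> *; apply: nat_trans_eq. Qed.

Record adjunction (A B : category) (F : functor A B) (G : functor B A) :=
  Adjunction {
    adj_unit : nat_trans (idF A) (compF G F);
    adj_counit : nat_trans (compF F G) (idF B);
    triangleL : forall a, adj_counit (F a) ∘ fmap F (adj_unit a) = idm (F a);
    triangleR : forall b, fmap G (adj_counit b) ∘ adj_unit (G b) = idm (G b)
  }.

Record cone (J C : category) (D : functor J C) := Cone {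
  apex : C;
  leg :> forall A, hom apex (D A);
  cone_comm : forall (A B : J) (f : hom A B), fmap D f ∘ leg A = leg B
}.

Definition is_limit (J C : category) (D : functor J C) (l : cone D) : Prop :=
  forall c : cone D,
    exists! u : hom (apex c) (apex l), forall A, l A ∘ u = c A.

Definition weakly_initial (J : category) (Ω : J -> Prop) : Prop :=
  forall B : J, exists A : J, Ω A /\ inhabited (hom A B).

Definition is_dagger_limit (J : category) (C : dagger_category)
    (D : functor J C) (Ω : J -> Prop) (l : cone D) : Prop :=
  is_limit l
  /\ (forall A, Ω A -> partial_isometry (l A))
  /\ (forall A B, Ω A -> Ω B ->
        (l A)† ∘ l A ∘ (l B)† ∘ l B = (l B)† ∘ l B ∘ (l A)† ∘ l A).

Definition has_dagger_limits (J : category) (Ω : J -> Prop)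
    (C : dagger_category) : Prop :=
  forall D : functor J C, exists l : cone D, is_dagger_limit Ω l.

(* Main.v *)
From Stdlib Require Import ssreflect ssrfun.
From Stdlib Require Import IndefiniteDescription.
Require Import Defs.
Local Open Scope cat_scope.

(** That a choice of limits for all diagrams is the same as a right adjoint of
    the diagonal, with the limiting cones as counit, is classical
    ([limit_adjunction] and [counit_cone_is_limit]).  Through this
    correspondence the conditions that [d] be partially isometric on [Ω] and
    that the [ρ A] commute are the two conditions singling out dagger limits
    among limits, so the content is that for dagger limits [Lhat] preserves
    daggers and each [ρ A] is natural.

    Let [l] and [m] be dagger limits of [D] and [E], let [s : D => E] be
    adjointable, and let [f : apex l -> apex m] and [g : apex m -> apex l] be
    the maps induced by [s] and [s†].  Write [p A = (l A)† ∘ l A] and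
    [q A = (m A)† ∘ m A].  Taking the dagger of [l A ∘ g = (s A)† ∘ m A] and
    composing with [l A] gives, at every object [A],
       [g† ∘ p A = (m A)† ∘ s A ∘ l A = q A ∘ f].
    Thus [f] and [g†] agree up to exchanging projections.  For [A], [B] in [Ω],
    this exchange together with the commutation and idempotence of the
    projections gives [q A ∘ f ∘ p B = q A ∘ q B ∘ f] ([idempotent_exchange]).
    As [m A = m A ∘ q A] and the legs in [Ω] are jointly monic by weak
    initiality, [f ∘ p B = q B ∘ f]: this is the naturality.  Hence
    [g† ∘ p B = f ∘ p B], that is [l B ∘ g = l B ∘ f†] for all [B] in [Ω],
    and joint monicity again gives [g = f†]. *)

Set Implicit Arguments.
Unset Strict Implicit.
Unset Printing Implicit Defensive.

Lemma limit_legs_jointly_monic (J C : category) (D : functor J C) (l : cone D)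
    (x : C) (u v : hom x (apex l)) :
  is_limit l -> (forall A, l A ∘ u = l A ∘ v) -> u = v.
Proof.
move=> lim_l uv.
have comm (A B : J) (h : hom A B) : fmap D h ∘ (l A ∘ v) = l B ∘ v.
  by rewrite compA cone_comm.
have [w [_ w_uniq]] := lim_l (Cone comm).
by rewrite -(w_uniq u uv) (w_uniq v).
Qed.

(** Every leg factors through a leg in [Ω]. *)
Lemma weakly_initial_legs_jointly_monic (J C : category) (Ω : J -> Prop)
    (D : functor J C) (l : cone D) (x : C) (u v : hom x (apex l)) :
  weakly_initial Ω -> is_limit l ->
  (forall A, Ω A -> l A ∘ u = l A ∘ v) -> u = v.
Proof.
move=> init lim_l uv; apply: (limit_legs_jointly_monic lim_l) => B.
have [A [ΩA [h]]] := init B.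
by rewrite -(cone_comm l h) -!compA uv.
Qed.

Definition nat_cone (J C : category) (x : C) (D : functor J C)
    (t : nat_trans (constF J x) D) : cone D.
Proof.
by exists x (component t) => A B h; rewrite (naturality t) /= compm1.
Defined.

Definition cone_nat (J C : category) (D : functor J C) (c : cone D) :
  nat_trans (constF J (apex c)) D.
Proof.
by exists (leg c) => A B h; rewrite cone_comm /= compm1.
Defined.

Definition mediating (J C : category) (D : functor J C) (l : cone D)
    (lim_l : is_limit l) (x : C) (t : nat_trans (constF J x) D) :
    hom x (apex l) :=
  proj1_sig (constructive_indefinite_description _ (lim_l (nat_cone t))).

Lemma mediatingE (J C : category) (D : functor J C) (l : cone D)
    (lim_l : is_limit l) (x : C) (t : nat_trans (constF J x) D) (A : J) :
  l A ∘ mediating lim_l t = t A.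
Proof.
rewrite /mediating.
by case: (constructive_indefinite_description _ _) => u [/= uE _].
Qed.

Section LimitFunctor.
Variables (J C : category) (lim : forall D : functor J C, cone D).
Hypothesis limP : forall D, is_limit (lim D).

Definition lim_map (D E : functor J C) (s : nat_trans D E) :
    hom (apex (lim D)) (apex (lim E)) :=
  mediating (@limP E) (compN s (cone_nat (lim D))).

Lemma lim_mapE (D E : functor J C) (s : nat_trans D E) (A : J) :
  lim E A ∘ lim_map s = s A ∘ lim D A.
Proof. exact: mediatingE. Qed.

Lemma lim_map1 (D : Cat J C) : lim_map (idm D) = idm (apex (lim D)).
Proof.
apply: (limit_legs_jointly_monic (@limP D)) => A.
by rewrite lim_mapE comp1m compm1.
Qed.

Lemma lim_mapM (D E F : Cat J C) (t : hom E F) (s : hom D E) :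
  lim_map (t ∘ s) = lim_map t ∘ lim_map s.
Proof.
apply: (limit_legs_jointly_monic (@limP F)) => A.
by rewrite compA !lim_mapE -compA lim_mapE compA.
Qed.

Definition limit_functor : functor (Cat J C) C :=
  @Functor (Cat J C) C (fun D => apex (lim D)) lim_map lim_map1 lim_mapM.

Definition limit_unit (x : C) : hom x (apex (lim (constF J x))) :=
  mediating (@limP _) (idN (constF J x)).

Lemma limit_unitE (x : C) (A : J) : lim (constF J x) A ∘ limit_unit x = idm x.
Proof. exact: mediatingE. Qed.

Lemma limit_unit_natural :
  @is_natural _ _ (idF C) (compF limit_functor (Delta J C)) limit_unit.
Proof.
move=> x y h; apply: (limit_legs_jointly_monic (@limP _)) => A /=.
rewrite !compA (lim_mapE (constN J h)) limit_unitE /= comp1m.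
by rewrite -compA limit_unitE compm1.
Qed.

Definition limit_counit (D : Cat J C) :
  nat_trans (constF J (apex (lim D))) D := cone_nat (lim D).

Lemma limit_counit_natural :
  @is_natural _ _ (compF (Delta J C) limit_functor) (idF (Cat J C)) limit_counit.
Proof.
by move=> D E s; apply: nat_trans_eq => A /=; rewrite lim_mapE.
Qed.

Definition limit_adjunction : adjunction (Delta J C) limit_functor.
Proof.
exists (NatTrans limit_unit_natural) (NatTrans limit_counit_natural).
- by move=> x; apply: nat_trans_eq => A; apply: limit_unitE.
- move=> D; apply: (limit_legs_jointly_monic (@limP D)) => A /=.
  by rewrite compA lim_mapE -compA /= limit_unitE !compm1.
Defined.

End LimitFunctor.

(** A cone is a natural transformation from a constant functor; its transpose
    under the adjunction is the mediating map. *)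
Lemma counit_cone_is_limit (J C : category) (L : functor (Cat J C) C)
    (adj : adjunction (Delta J C) L) (D : functor J C) :
  is_limit (nat_cone (adj_counit adj D)).
Proof.
move=> c; set t : @hom (Cat J C) (Delta J C (apex c)) D := cone_nat c.
exists (fmap L t ∘ adj_unit adj (apex c)); split.
- move=> A /=.
  have /= tri := f_equal (fun s => component s A) (triangleL adj (apex c)).
  have /= nat := f_equal (fun s => component s A) (naturality (adj_counit adj) t).
  by rewrite compA -nat -compA tri compm1.
- move=> u /= uE.
  have -> : t = adj_counit adj D ∘ fmap (Delta J C) u.
    by apply: nat_trans_eq => A; rewrite /= uE.
  have /= nat := naturality (adj_unit adj) u.
  have /= tri := triangleR adj D.
  by rewrite fmapM -compA nat compA tri comp1m.
Qed.

Lemma partial_isometry_proj (C : dagger_category) (x y : C) (f : hom x y) :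
  partial_isometry f -> f ∘ (f† ∘ f) = f.
Proof. by rewrite compA. Qed.

(** Exchanging [p], then [p'], in [h ∘ p ∘ p'] gives
    [q ∘ f ∘ p' = q' ∘ f ∘ p]; composing with [q], which can be moved past
    [q'], makes [p] disappear because [q ∘ f ∘ p = h ∘ p ∘ p = q ∘ f]. *)
Lemma idempotent_exchange (C : category) (x y : C) (f h : hom x y)
    (p p' : hom x x) (q q' : hom y y) :
  p ∘ p = p -> q ∘ q = q -> p ∘ p' = p' ∘ p -> q ∘ q' = q' ∘ q ->
  h ∘ p = q ∘ f -> h ∘ p' = q' ∘ f -> q ∘ f ∘ p' = q ∘ q' ∘ f.
Proof.
move=> pp qq pC qC hp hp'.
have swap : q ∘ f ∘ p' = q' ∘ f ∘ p by rewrite -hp -hp' -!compA pC.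
have absorb : q ∘ f ∘ p = q ∘ f by rewrite -hp -compA pp.
by rewrite -{1}qq -!compA (compA q f) swap !compA qC -!compA (compA q) absorb.
Qed.

Section InducedMaps.
Variables (J : category) (C : dagger_category) (Ω : J -> Prop).
Hypothesis init : weakly_initial Ω.
Variables (D E : functor J C) (s : adj_trans D E) (l : cone D) (m : cone E).
Hypotheses (lim_l : is_dagger_limit Ω l) (lim_m : is_dagger_limit Ω m).
Variables (f : hom (apex l) (apex m)) (g : hom (apex m) (apex l)).
Hypothesis fE : forall A, m A ∘ f = s A ∘ l A.
Hypothesis gE : forall A, l A ∘ g = (s A)† ∘ m A.

Let p A : hom (apex l) (apex l) := (l A)† ∘ l A.
Let q A : hom (apex m) (apex m) := (m A)† ∘ m A.

Let l_p A : Ω A -> l A ∘ p A = l A.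
Proof. by move=> ΩA; apply/partial_isometry_proj/lim_l.2.1. Qed.

Let m_q A : Ω A -> m A ∘ q A = m A.
Proof. by move=> ΩA; apply/partial_isometry_proj/lim_m.2.1. Qed.

Let p_comm A B : Ω A -> Ω B -> p A ∘ p B = p B ∘ p A.
Proof. by move=> ΩA ΩB; rewrite /p !compA lim_l.2.2. Qed.

Let q_comm A B : Ω A -> Ω B -> q A ∘ q B = q B ∘ q A.
Proof. by move=> ΩA ΩB; rewrite /q !compA lim_m.2.2. Qed.

(** Both sides are [(m A)† ∘ s A ∘ l A]. *)
Lemma dag_induced_map_proj A : g† ∘ p A = q A ∘ f.
Proof. by rewrite /p compA -dagM gE dagM dagK /q -!compA fE. Qed.

Lemma induced_map_exchange A B : Ω A -> Ω B -> q A ∘ f ∘ p B = q A ∘ q B ∘ f.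
Proof.
move=> ΩA ΩB; apply: (@idempotent_exchange _ _ _ f g† (p A) (p B)).
- by rewrite {1}/p -compA l_p.
- by rewrite {1}/q -compA m_q.
- exact: p_comm.
- exact: q_comm.
- exact: dag_induced_map_proj.
- exact: dag_induced_map_proj.
Qed.

Lemma induced_map_proj_natural B : Ω B -> f ∘ p B = q B ∘ f.
Proof.
move=> ΩB; apply: (weakly_initial_legs_jointly_monic init lim_m.1) => A ΩA.
rewrite -(m_q ΩA) -(compA (m A) (q A) (f ∘ _)) -(compA (m A) (q A) (q B ∘ _)).
by rewrite (compA (q A) f) (compA (q A) (q B)) induced_map_exchange.
Qed.

Lemma induced_map_dag : g = f†.
Proof.
apply: (weakly_initial_legs_jointly_monic init lim_l.1) => B ΩB.
have e : g† ∘ p B = f ∘ p B.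
  by rewrite dag_induced_map_proj induced_map_proj_natural.
have {}e : p B ∘ g = p B ∘ f†.
  by move: (f_equal dag e); rewrite !dagM !dagK.
by rewrite -(l_p ΩB) -(compA (l B) (p B) g) -(compA (l B) (p B) f†) e.
Qed.

End InducedMaps.

Theorem theorem6p1 (J : category) (Ω : J -> Prop) (hΩ : weakly_initial Ω)
    (C : dagger_category) :
  has_dagger_limits Ω C <->
  exists (L : functor (Cat J C) C) (adj : adjunction (Delta J C) L),
    let d (D : functor J C) (A : J) : hom (L D) (D A) :=
      component (adj_counit adj D) A in
    let Lhat : functor (DagCat J C) C := compF L (DagCat_incl J C) in
    let ρ (A : J) (D : DagCat J C) : hom (Lhat D) (Lhat D) :=
      (d D A)† ∘ d D A in
    (forall (D : functor J C) (A : J), Ω A -> partial_isometry (d D A))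
    /\ is_dagger_functor Lhat
    /\ (forall A : J, Ω A -> is_natural (ρ A))
    /\ (forall A B : J, Ω A -> Ω B ->
          forall D : DagCat J C, ρ A D ∘ ρ B D = ρ B D ∘ ρ A D).
Proof.
split=> [has_lim | [L [adj [iso [_ [_ comm]]]]] D].
- pose chosen D := constructive_indefinite_description _ (has_lim D).
  pose lim D := proj1_sig (chosen D).
  have limP D : is_dagger_limit Ω (lim D) := proj2_sig (chosen D).
  exists (limit_functor (fun D => (limP D).1)).
  exists (limit_adjunction (fun D => (limP D).1)) => /=; split; [|split; [|split]].
  + by move=> D A ΩA; apply: (limP D).2.1.
  + move=> D E s /=.
    apply: (induced_map_dag hΩ (s := s) (limP D) (limP E)) => A;
      by rewrite lim_mapE.
  + move=> A ΩA D E s /=.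
    apply: (induced_map_proj_natural hΩ (s := s) (limP D) (limP E)
      (g := lim_map (fun D => (limP D).1) (dagN s))) => // B;
      by rewrite lim_mapE.
  + by move=> A B ΩA ΩB D; rewrite !compA; apply: (limP D).2.2.
- exists (nat_cone (adj_counit adj D)); split; first exact: counit_cone_is_limit.
  split=> [A ΩA | A B ΩA ΩB]; first exact: iso.
  by have := comm A B ΩA ΩB D; rewrite !compA.
Qed.
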